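(* Let $E$ be an edge of $G$ with initial vertex $V_1$ and terminal vertex $V_2$, where $V_1$ is a periodic point of $f$ with period $m$ and rotation element $w_1^{1/m}$ and $V_2$ is a periodic point of $f$ with period $n$ and rotation element $w_2^{1/n}$ (so $\widetilde f^m(\widetilde V_1)=w_1\widetilde V_1$ and $\widetilde f^n(\widetilde V_2)=w_2\widetilde V_2$), and $E$ belongs to the spanning tree used for the coherent labeling. Let $\widetilde P_1$ and $\widetilde P_2$ be the shortest paths in $\widetilde G$ from $\widetilde V_1$ to $w_1\widetilde V_1$ and from $\widetilde V_2$ to $w_2\widetilde V_2$, respectively. If $E$ belongs to both $w_1$ and $w_2$ and both $\widetilde P_1$ and $\widetilde P_2$ begin with $\widetilde E$, then for any rational numbers $r$ and $s$ satisfying $0\le r<1/m$ and $0\le s<1/n$ there are periodic points of $f$ in $E$ with rotation elements $w_1^r$ and $w_2^s$.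
   Context: $G$ is a finite connected directed graph (multiple edges allowed, no looped edges) with base vertex $x_0$; $\pi=\pi_1(G,x_0)$, a free group; $\widetilde G$ is the universal cover of $G$, a tree. Elements of $\pi$ are identified with covering transformations of $\widetilde G$ (after fixing a lift $\widetilde x_0$ of $x_0$, the lift at $\widetilde x_0$ of a loop in class $\gamma$ ends at $\gamma\widetilde x_0$), and products act by $(\alpha\beta)\widetilde x=\alpha(\beta\widetilde x)$. Coherent labeling: choose a spanning tree $\mathcal T$ of $G$ rooted at $x_0$ and lift it to a tree in $\widetilde G$ through $\widetilde x_0$; this defines the chosen lifts $\widetilde V$ of all vertices and $\widetilde E$ of all edges of $\mathcal T$. For an edge $E\notin\mathcal T$ with initial vertex $V$, $\widetilde E$ is the lift of $E$ starting at $\widetilde V$. For $x$ in the interior of an edge $E$, $\widetilde x$ is the point of $\widetilde E$ over $x$; for a vertex, $\widetilde x$ is its chosen lift. The labeling is coherent with $E\in\mathcal T$, so $\widetilde E$ goes from $\widetilde V_1$ to $\widetilde V_2$. $f:G\to G$ is a continuous vertex map (it permutes the vertices of $G$) homotopic to the identity, and $\widetilde f$ is a fixed lift with $\widetilde f(\gamma\widetilde x)=\gamma\widetilde f(\widetilde x)$ for all $\gamma\in\pi$. Rotation element: for $x\in\mathrm{Fix}(f^n)$, let $w\in\pi$ satisfy $\widetilde f^n(\widetilde x)=w\widetilde x$; then $\rho(x)=w^{1/n}$. Rational powers are formal, modulo $(w^k)^r=w^{kr}$ for integers $k$ and rationals $r$ (equivalently they lie in the free $\mathbb Q$-group, where $w^{1/n}=v^{1/m}$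 iff $w^m=v^n$); in particular $w^{p/q}=(w^p)^{1/q}$. A path begins with $\widetilde E$ if its initial edge is $\widetilde E$ or $\widetilde E^{-1}$ (the reversed edge). Belonging: an edge loop in $G$ is cyclically reduced when its first edge is not the reverse of its last edge (and it has no backtracking). Every loop can be contracted onto a cyclically reduced loop by changing the base point to another vertex of the loop and canceling adjacent inverse edges; the result is called a cyclic reduction. An edge $E$ belongs to $\alpha\in\pi$ when every cyclic reduction of $\alpha$ uses $E$ or $E^{-1}$. *)

(* Defs.v *)
From HB Require Import structures.
From mathcomp Require Import all_boot all_order all_algebra.
From mathcomp Require Import all_classical all_reals all_analysis.

Set Implicit Arguments.
Unset Strict Implicit.
Unset Printing Implicit Defensive.

Import Order.TTheory GRing.Theory Num.Theory.
Import numFieldNormedType.Exports.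
Local Open Scope classical_set_scope.
Local Open Scope ring_scope.

(** * Directed multigraphs and edge paths *)

(* Vertices and edges may be infinite in number, so that the same type serves
   for a finite graph and for its universal cover. *)
Record graph := Graph {
  vtx : choiceType;
  edg : choiceType;
  src : edg -> vtx;
  tgt : edg -> vtx }.

Definition finite_graph (G : graph) : Prop :=
  finite_set [set: vtx G] /\ finite_set [set: edg G].

Definition loopless (G : graph) : Prop := forall e : edg G, src e != tgt e.

Section EdgePaths.
Variable G : graph.

(* [(e, false)] is the edge [e] and [(e, true)] is its reverse. *)
Definition dart := (edg G * bool)%type.
Definition dinv (d : dart) : dart := (d.1, ~~ d.2).
Definition dsrc (d : dart) : vtx G := if d.2 then tgt d.1 else src d.1.
Definition dtgt (d : dart) : vtx G := if d.2 then src d.1 else tgt d.1.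

Fixpoint walk (x : vtx G) (s : seq dart) : bool :=
  if s is d :: s' then (dsrc d == x) && walk (dtgt d) s' else true.
Definition wend (x : vtx G) (s : seq dart) : vtx G := last x (map dtgt s).
Definition walk_to (x y : vtx G) (s : seq dart) : bool :=
  walk x s && (wend x s == y).

Definition noback : rel dart := fun d d' => d' != dinv d.
Definition reduced (s : seq dart) : bool := sorted noback s.

(* [cycle] also tests the pair formed by the last and the first edge. *)
Definition cyclically_reduced (s : seq dart) : bool := cycle noback s.

Definition red_cons (d : dart) (s : seq dart) : seq dart :=
  if s is d' :: s' then if d' == dinv d then s' else d :: s else [:: d].
Definition red (s : seq dart) : seq dart := foldr red_cons [::] s.

Definition winv (s : seq dart) : seq dart := rev (map dinv s).

Definition connected_graph : Prop := forall x y, exists s, walk_to x y s.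

Definition spanning_tree (T : {pred edg G}) : Prop :=
  (forall x y, exists2 s, walk_to x y s & all (fun d => d.1 \in T) s) /\
  (forall x s, walk_to x x s -> reduced s -> all (fun d => d.1 \in T) s ->
     s = [::]).

Definition shortest_path (x y : vtx G) (s : seq dart) : Prop :=
  walk_to x y s /\ forall s', walk_to x y s' -> (size s <= size s')%N.

Definition begins_with (e : edg G) (s : seq dart) : bool :=
  if s is d :: _ then d.1 == e else false.

(* Change of base point along a closed path, and cancellation of adjacent
   inverse edges. *)
Inductive contracts : seq dart -> seq dart -> Prop :=
| contracts_refl s : contracts s s
| contracts_rot k s t : contracts (rot k s) t -> contracts s t
| contracts_cancel s1 d s2 t :
    contracts (s1 ++ s2) t -> contracts (s1 ++ d :: dinv d :: s2) t.

Lemma dinvK : involutive dinv.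
Proof. by case=> e b; rewrite /dinv /= negbK. Qed.

Lemma dsrc_inv d : dsrc (dinv d) = dtgt d.
Proof. by case: d => e []. Qed.

Lemma dtgt_inv d : dtgt (dinv d) = dsrc d.
Proof. by case: d => e []. Qed.

Lemma red_cons_reduced d s : reduced s -> reduced (red_cons d s).
Proof.
case: s => [|d' s] //= ps; case: eqP => [_|/eqP h] /=.
  exact: path_sorted ps.
by rewrite ps andbT.
Qed.

Lemma foldr_red_reduced s t : reduced t -> reduced (foldr red_cons t s).
Proof. by move=> rt; elim: s => //= d s IH; exact: red_cons_reduced. Qed.

Lemma red_reduced s : reduced (red s).
Proof. exact: foldr_red_reduced. Qed.

Lemma red_id s : reduced s -> red s = s.
Proof.
elim: s => //= d s IH ps.
rewrite -/(red s) IH; last exact: path_sorted ps.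
by case: s ps {IH} => //= d' s /andP[/negbTE h _]; rewrite h.
Qed.

Lemma red_consK d s : reduced s -> red_cons d (red_cons (dinv d) s) = s.
Proof.
case: s => [|d' s] /= ps; first by rewrite eqxx.
rewrite dinvK; case: eqP => [e|_] /=; last by rewrite eqxx.
subst d'; case: s ps => //= d'' s /andP[h _].
by rewrite (negbTE h).
Qed.

Lemma foldr_red_cons d s t : reduced s -> reduced t ->
  foldr red_cons t (red_cons d s) = red_cons d (foldr red_cons t s).
Proof.
case: s => [|d' s] //= _ rt; case: eqP => //= ->.
by rewrite red_consK //; exact: foldr_red_reduced.
Qed.

Lemma foldr_red s t : reduced t ->
  foldr red_cons t (red s) = foldr red_cons t s.
Proof.
move=> rt; elim: s => //= d s IH.
by rewrite foldr_red_cons ?IH //; exact: red_reduced.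
Qed.

Lemma red_catl s t : red (red s ++ t) = red (s ++ t).
Proof. by rewrite /red !foldr_cat foldr_red //; exact: red_reduced. Qed.

Lemma red_catr s t : red (s ++ red t) = red (s ++ t).
Proof.
by rewrite /red !foldr_cat -/(red (red t)) -/(red t) (red_id (red_reduced t)).
Qed.

Lemma red_winvl s : red (winv s ++ s) = [::].
Proof.
elim: s => //= d s IH.
rewrite /winv map_cons rev_cons cat_rcons /red foldr_cat /= -/(red s).
rewrite -{2}(dinvK d) red_consK; last exact: red_reduced.
by rewrite -[RHS]IH /red foldr_cat.
Qed.

Lemma wend_cat x s t : wend x (s ++ t) = wend (wend x s) t.
Proof. by rewrite /wend map_cat last_cat. Qed.

Lemma walk_cat x s t : walk x (s ++ t) = walk x s && walk (wend x s) t.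
Proof. by elim: s x => //= d s IH x; rewrite IH andbA. Qed.

Lemma walk_red x s : walk x s -> walk x (red s) /\ wend x (red s) = wend x s.
Proof.
elim: s x => //= d s IH x /andP[/eqP <- /IH[]].
rewrite -/(red s) /wend /= => + <-; case: (red s) => [|d' t] /=.
  by rewrite eqxx.
case/andP=> /eqP h w; case: eqP => [e|_] /=.
  by rewrite e dtgt_inv in w *.
by rewrite h !eqxx w.
Qed.

Lemma walk_winv x s : walk x s -> walk_to (wend x s) x (winv s).
Proof.
rewrite /walk_to; elim: s x => [|d s IH] x /=; first by rewrite /wend /= eqxx.
case/andP=> /eqP <- /IH /andP[w e].
rewrite /winv map_cons rev_cons -cats1 walk_cat wend_cat -/(winv s) w.
by rewrite (eqP e) /wend /= dsrc_inv dtgt_inv !eqxx.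
Qed.

End EdgePaths.

(** * The fundamental group and the universal cover *)

Section UniversalCover.
Variables (G : graph) (x0 : vtx G).

(* A class of edge loops at [x0], given by its reduced representative. *)
Record pi1 := Pi1 {
  pi1_loop : seq (dart G);
  pi1P : walk_to x0 x0 pi1_loop && reduced pi1_loop }.
HB.instance Definition _ := [isSub of pi1 for pi1_loop].
HB.instance Definition _ := [Choice of pi1 by <:].

Lemma pi1_mul_subproof (a b : pi1) :
  let s := red (val a ++ val b) in walk_to x0 x0 s && reduced s.
Proof.
case: a b => [a /andP[/andP[wa /eqP ea] _]] [b /andP[/andP[wb /eqP eb] _]] /=.
have /walk_red[] : walk x0 (a ++ b) by rewrite walk_cat wa ea wb.
by rewrite /walk_to red_reduced => -> ->; rewrite wend_cat ea eb eqxx.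
Qed.
Definition pi1_mul (a b : pi1) : pi1 := Pi1 (pi1_mul_subproof a b).

Lemma pi1_one_subproof : walk_to x0 x0 [::] && reduced (G := G) [::].
Proof. by rewrite /walk_to /= /wend /= eqxx. Qed.
Definition pi1_one : pi1 := Pi1 pi1_one_subproof.

Lemma pi1_inv_subproof (a : pi1) :
  let s := red (winv (val a)) in walk_to x0 x0 s && reduced s.
Proof.
case: a => a /= /andP[/andP[wa /eqP ea] _].
have := walk_winv wa; rewrite ea => /andP[/walk_red[w e] e'].
by rewrite /walk_to w e e' red_reduced.
Qed.
Definition pi1_inv (a : pi1) : pi1 := Pi1 (pi1_inv_subproof a).

Lemma pi1_mulA : associative pi1_mul.
Proof. by move=> a b c; apply/val_inj; rewrite /= red_catr red_catl catA. Qed.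

Lemma pi1_mul1 : left_id pi1_one pi1_mul.
Proof.
by move=> a; apply/val_inj; rewrite /= red_id //; case: a => a /= /andP[].
Qed.

Lemma pi1_mulr1 : right_id pi1_one pi1_mul.
Proof.
move=> a; apply/val_inj; rewrite /= cats0 red_id //.
by case: a => a /= /andP[].
Qed.

Lemma pi1_mulV : left_inverse pi1_one pi1_inv pi1_mul.
Proof. by move=> a; apply/val_inj; rewrite /= red_catl red_winvl. Qed.

Lemma pi1_mulrV : right_inverse pi1_one pi1_inv pi1_mul.
Proof.
move=> a; rewrite -[LHS]pi1_mul1 -{1}(pi1_mulV (pi1_inv a)) -pi1_mulA.
by rewrite (pi1_mulA (pi1_inv a)) pi1_mulV pi1_mul1 pi1_mulV.
Qed.

HB.instance Definition _ := isGroup.Build pi1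
  pi1_mulA pi1_mul1 pi1_mulr1 pi1_mulV pi1_mulrV.

(* Vertices of the universal cover: reduced edge paths issued from [x0]; the
   covering projection sends such a path to its end point. *)
Record cover_vtx := CoverVtx {
  cover_path : seq (dart G);
  cover_vtxP : walk x0 cover_path && reduced cover_path }.
HB.instance Definition _ := [isSub of cover_vtx for cover_path].
HB.instance Definition _ := [Choice of cover_vtx by <:].
Definition cover_vproj (p : cover_vtx) : vtx G := wend x0 (val p).

(* The edge [(p, e)] is the lift of [e] that starts at [p]. *)
Record cover_edg := CoverEdg {
  cover_pair : cover_vtx * edg G;
  cover_edgP : cover_vproj cover_pair.1 == src cover_pair.2 }.
HB.instance Definition _ := [isSub of cover_edg for cover_pair].
HB.instance Definition _ := [Choice of cover_edg by <:].
Definition cover_eproj (z : cover_edg) : edg G := (val z).2.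
Definition cover_src (z : cover_edg) : cover_vtx := (val z).1.

Lemma cover_tgt_subproof (z : cover_edg) :
  let s := red (rcons (val (val z).1) ((val z).2, false)) in
  walk x0 s && reduced s.
Proof.
case: z => [[[p hp] e] /= h]; have [wp _] := andP hp.
have /walk_red[-> _] : walk x0 (rcons p (e, false)).
  by rewrite -cats1 walk_cat wp /= /dsrc /= -(eqP h) eqxx.
exact: red_reduced.
Qed.
Definition cover_tgt (z : cover_edg) : cover_vtx :=
  CoverVtx (cover_tgt_subproof z).

Definition ucover : graph := Graph cover_src cover_tgt.

Lemma cover_base_subproof : walk x0 [::] && reduced (G := G) [::].
Proof. by []. Qed.
Definition cover_base : vtx ucover := CoverVtx cover_base_subproof.

Lemma act_vtx_subproof (a : pi1) (p : cover_vtx) :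
  let s := red (val a ++ val p) in walk x0 s && reduced s.
Proof.
case: a p => [a /andP[/andP[wa /eqP ea] _]] [p /andP[wp _]] /=.
have /walk_red[-> _] : walk x0 (a ++ p) by rewrite walk_cat wa ea wp.
exact: red_reduced.
Qed.
Definition act_vtx (a : pi1) (p : vtx ucover) : vtx ucover :=
  CoverVtx (act_vtx_subproof a p).

Lemma act_edg_subproof (a : pi1) (z : cover_edg) :
  cover_vproj (act_vtx a (val z).1) == src (val z).2.
Proof.
case: a z => [a ha] [[[p hp] e] h] /=.
have [/andP[wa /eqP ea] _] := andP ha; have [wp _] := andP hp; rewrite -(eqP h) /cover_vproj /=.
have /walk_red[_ ->] : walk x0 (a ++ p) by rewrite walk_cat wa ea wp.
by rewrite wend_cat ea.
Qed.
Definition act_edg (a : pi1) (z : edg ucover) : edg ucover :=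
  @CoverEdg (act_vtx a (val z).1, (val z).2) (act_edg_subproof a z).

(** * Coherent labelings *)

(* A spanning tree together with its lift through the base point. *)
Record coherent_labeling := CoherentLabeling {
  cl_tree : {pred edg G};
  cl_tree_spanning : spanning_tree cl_tree;
  vlift : vtx G -> vtx ucover;
  vlift_over : forall v, cover_vproj (vlift v) == v;
  vlift_base : vlift x0 = cover_base;
  vlift_tree : forall e, e \in cl_tree -> exists e' : edg ucover,
    [/\ cover_eproj e' = e, src e' = vlift (src e) & tgt e' = vlift (tgt e)] }.

(* For an edge of the tree this is the edge given by [vlift_tree], as an edge
   of the cover is determined by its image and its initial vertex. *)
Definition elift (L : coherent_labeling) (e : edg G) : edg ucover :=
  @CoverEdg (vlift L (src e), e) (vlift_over L (src e)).

(** * Belonging, and formal rational powers *)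

Definition cyclic_reduction (a : pi1) (c : seq (dart G)) : Prop :=
  exists l, [/\ walk_to x0 x0 l, red l = val a, contracts l c
              & cyclically_reduced c].

Definition belongs (e : edg G) (a : pi1) : Prop :=
  forall c, cyclic_reduction a c -> e \in map fst c.

Definition zpow (a : pi1) (k : int) : pi1 :=
  match k with Posz n => (a ^+ n)%g | Negz n => (a ^- n.+1)%g end.

(* [(w, r)] stands for the formal power w^r; the congruence is generated by
   (w^k)^r = w^(kr). *)
Inductive qpow_eq : pi1 * rat -> pi1 * rat -> Prop :=
| qpow_refl a : qpow_eq a a
| qpow_sym a b : qpow_eq a b -> qpow_eq b a
| qpow_trans a b c : qpow_eq a b -> qpow_eq b c -> qpow_eq a c
| qpow_mul w (k : int) (r : rat) : qpow_eq (zpow w k, r) (w, k%:~R * r).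

End UniversalCover.

(** * Geometric realization *)

Section Realization.
Variables (R : realType) (G : graph).

Definition realization : Type := (vtx G + edg G * {t : R | 0 < t < 1})%type.
HB.instance Definition _ := Choice.on realization.

Definition vpt (v : vtx G) : realization := inl v.

(* Characteristic map of an edge, extended to [R] by constants. *)
Definition ept (e : edg G) (t : R) : realization :=
  if insub t is Some u then inr (e, u)
  else inl (if t <= 0 then src e else tgt e).

(* The weak (CW) topology. Since [ept e] factors through the retraction of [R]
   onto [0, 1], a set has an open preimage in [R] iff it has an open preimage in
   the closed unit interval. *)
Definition realization_open : set_system realization :=
  [set U | forall e, open (ept e @^-1` U)].

Lemma realization_openT : realization_open setT.
Proof. by move=> e; rewrite preimage_setT; exact: openT. Qed.

Lemma realization_openI : setI_closed realization_open.
Proof. by move=> A B oA oB e; rewrite preimage_setI; exact: openI. Qed.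

Lemma realization_open_bigU (I : Type) (f : I -> set realization) :
  (forall i, realization_open (f i)) -> realization_open (\bigcup_i f i).
Proof.
by move=> of_ e; rewrite preimage_bigcup; apply: bigcup_open => i _; exact: of_.
Qed.

HB.instance Definition _ := isOpenTopological.Build realization
  realization_openT realization_openI realization_open_bigU.

Definition closed_edge (e : edg G) : set realization := ept e @` `[0, 1].

Definition vertex_map (f : realization -> realization) : Prop :=
  exists2 s : vtx G -> vtx G, bijective s & forall v, f (vpt v) = vpt (s v).

Definition homotopic (f g : realization -> realization) : Prop :=
  exists H : realization * R -> realization,
    [/\ {within [set z | 0 <= z.2 <= 1], continuous H},
        forall x, H (x, 0) = f x & forall x, H (x, 1) = g x].

End Realization.

Definition realization_map (R : realType) (G H : graph)
    (gv : vtx G -> vtx H) (ge : edg G -> edg H)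
    (x : realization R G) : realization R H :=
  match x with inl v => inl (gv v) | inr (e, t) => inr (ge e, t) end.

Section Rotation.
Variables (R : realType) (G : graph) (x0 : vtx G).

Local Notation cover := (realization R (ucover x0)).

Definition cover_proj : cover -> realization R G :=
  @realization_map R (ucover x0) G (@cover_vproj G x0) (@cover_eproj G x0).

Definition act (a : pi1 x0) : cover -> cover :=
  realization_map (act_vtx a) (act_edg a).

Definition plift (L : coherent_labeling x0) : realization R G -> cover :=
  realization_map (vlift L) (elift L).

Definition equivariant_lift (f : realization R G -> realization R G)
    (ft : cover -> cover) : Prop :=
  [/\ continuous ft, forall x, cover_proj (ft x) = f (cover_proj x)
    & forall a x, ft (act a x) = act a (ft x)].

(* [x] is fixed by [f^n] and its rotation element is w^(1/n). *)
Definition rotates (L : coherent_labeling x0)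
    (f : realization R G -> realization R G) (ft : cover -> cover)
    (n : nat) (w : pi1 x0) (x : realization R G) : Prop :=
  [/\ (0 < n)%N, iter n f x = x & iter n ft (plift L x) = act w (plift L x)].

Definition rotation_element (L : coherent_labeling x0)
    (f : realization R G -> realization R G) (ft : cover -> cover)
    (x : realization R G) (q : pi1 x0 * rat) : Prop :=
  exists n w, rotates L f ft n w x /\ qpow_eq (w, n%:R^-1) q.

End Rotation.

(* Main.v *)
(* Removing the lifted edge from the tree leaves two half-trees, A containing V1
   and B containing V2.  Write r = i / N with m and n dividing N, so that
   i < N / m, and g = w1^i; the case i = 0 is easy, so let i > 0.  Cyclically
   reducing words shows that the positive powers of w1 move V1 into B and those
   of w2 move V2 into A.  As g V1 is in B, the translate of the edge by g avoids
   A, so g^-1 A lies within A or within B.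
   - If g^-1 A is contained in A, then g^-1 ft^N sends V1 into B and V2 into A.
     Followed by the retraction of the tree onto the edge, it reverses the ends
     of the edge, so it has a fixed point in its interior.
   - Otherwise, write N = a + b with a = m i.  Then g^-1 ft^a fixes V1 and sends
     V2 into B, while ft^b sends V1 into B and V2 into A.  The composite of the
     two maps, with a retraction after each, reverses the ends of the edge; this
     forces a fixed point whose intermediate image is interior too.
   In both cases ft^N x = g x.  The second half of the theorem is the first one
   for the reversed edge. *)

Require Import Defs.
From HB Require Import structures.
From mathcomp Require Import all_boot all_order all_algebra.
From mathcomp Require Import all_classical all_reals all_analysis.
Set Implicit Arguments.
Unset Strict Implicit.
Unset Printing Implicit Defensive.
Import Order.TTheory GRing.Theory Num.Theory.
Import numFieldNormedType.Exports.
Local Open Scope classical_set_scope.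
Local Open Scope ring_scope.

(* MathComp-Analysis also exports a [dinv]. *)
Local Notation dinv := Defs.dinv.

(** * Reduced words, inverses and powers *)

Section Words.
Variable G : graph.
Implicit Types (d : dart G) (s t u : seq (dart G)).

Lemma red_catm s t u : red (s ++ red t ++ u) = red (s ++ t ++ u).
Proof. by rewrite -red_catr red_catl red_catr. Qed.

Lemma winv_cat s t : winv (s ++ t) = winv t ++ winv s.
Proof. by rewrite /winv map_cat rev_cat. Qed.

Lemma winvK : involutive (@winv G).
Proof. by move=> s; rewrite /winv map_rev revK mapK //; exact: dinvK. Qed.

Lemma red_winvr s : red (s ++ winv s) = [::].
Proof. by rewrite -{1}(winvK s) red_winvl. Qed.

Lemma red_catVm s t u : red (s ++ winv t ++ t ++ u) = red (s ++ u).
Proof. by rewrite (catA (winv t)) -red_catm red_winvl. Qed.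

Lemma red_catmV s t u : red (s ++ t ++ winv t ++ u) = red (s ++ u).
Proof. by rewrite (catA t) -red_catm red_winvr. Qed.

Lemma red_winv_red s t : red (winv (red s) ++ t) = red (winv s ++ t).
Proof.
by rewrite -[LHS](red_catmV _ s) -red_catm (red_catVm [::]).
Qed.

Lemma red_winvl_eq0 s t :
  reduced s -> reduced t -> red (winv s ++ t) = [::] -> s = t.
Proof.
move=> rs rt h; rewrite -(red_id rt) -(red_catmV [::] s) /= -red_catr h cats0.
by rewrite red_id.
Qed.

Lemma dinv_neq d : dinv d != d.
Proof. by case: d => e []; rewrite xpair_eqE andbF. Qed.

Lemma dart_same_edge d d' : d'.1 = d.1 -> d' = d \/ d' = dinv d.
Proof. by case: d d' => e [] [e' []] /= ->; [left|right|right|left]. Qed.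

(** Since [s] is reduced, a cancelled [dinv d] is never followed by [d]. *)
Lemma red_cons_ohead d s :
  reduced s -> (ohead (red_cons d s) == Some d) = (ohead s != Some (dinv d)).
Proof.
case: s => [|d' s] /= rs; first by rewrite eqxx.
rewrite (inj_eq Some_inj).
case: (d' =P dinv d) => [e|_] /=; last by rewrite eqxx.
subst d'; case: s rs => //= d' s /andP[/eqP h _].
by apply/negbTE/eqP => -[e]; apply: h; rewrite dinvK.
Qed.

(** Only the last letter of [s] can cancel, so the first letter can change only when [s] has at most
    one letter; the hypotheses on [d'] settle these cases. *)
Lemma ohead_red_rcons s d d' :
  reduced s -> d' != dinv d -> (s == [::]) && (d == d') = false ->
  (ohead (red (rcons s d)) == Some d') = (ohead s == Some d').
Proof.
elim/last_ind: s => [|s x _] /= rs h; first by rewrite (inj_eq Some_inj) => ->.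
move=> _; have [e|ne] := eqVneq d (dinv x).
  have := red_catmV s [:: x] [::]; rewrite /winv /= cats0 => cx.
  rewrite e -!cats1 -catA cx red_id; last first.
    by move: rs; rewrite /reduced -cats1 => /cat_sorted2[].
  case: s rs {cx} => //= _; apply/esym/negbTE/eqP => -[ex].
  by rewrite e dinvK ex eqxx in h.
rewrite red_id; first by case: (s).
rewrite /reduced -cats1 -(cats1 s) -catA /=.
case: s rs => [|y s] /=; first by rewrite /noback ne.
by rewrite /noback -cats1 !cat_path /= => /and3P[-> -> _]; rewrite ne.
Qed.

Definition wpow s k := flatten (nseq k s).

Lemma wpowS s k : wpow s k.+1 = s ++ wpow s k.
Proof. by []. Qed.

Lemma red_wpow s k : red (wpow (red s) k) = red (wpow s k).
Proof.
by elim: k => // k IH; rewrite !wpowS red_catl -red_catr IH red_catr.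
Qed.

Lemma red_wpow_conj s t k :
  red (wpow (winv t ++ s ++ t) k) = red (winv t ++ wpow s k ++ t).
Proof.
elim: k => [|k IH]; first by rewrite /wpow /= red_winvl.
rewrite !wpowS -red_catr IH red_catr -!catA.
by rewrite (catA (winv t) s) red_catmV -catA.
Qed.

Lemma reduced_wpow s k : cyclically_reduced s -> reduced (wpow s k).
Proof.
case: s => [|x s] cs; first by elim: k.
elim: k => // k IH; rewrite wpowS.
move: cs; rewrite /cyclically_reduced /= -cats1 cat_path /= andbT.
case/andP=> ps ls.
rewrite /reduced /= cat_path ps /=.
by move: IH; rewrite /reduced; case: k => //= k ->; rewrite ls.
Qed.

(* A word that is not cyclically reduced is conjugate, by its first letter, to a
   shorter one; the statement about both ends makes the induction go through. *)
Lemma red_wpow_ends s k x : s != [::] -> reduced s ->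
  [/\ red (wpow s k.+1) != [::], head x (red (wpow s k.+1)) = head x s
    & last x (red (wpow s k.+1)) = last x s].
Proof.
have [n] := ubnP (size s); elim: n s => // n IH [|y s] // ltn _ rs.
have [cs|ncs] := boolP (cyclically_reduced (y :: s)).
  rewrite red_id; last exact: reduced_wpow.
  split=> //; rewrite /wpow /= last_cat.
  by elim: k {IH} => //= k; rewrite last_cat.
have ls : y = dinv (last y s).
  by move: rs ncs; rewrite /reduced /cyclically_reduced /= rcons_path => -> /=
    /negPn/eqP.
case/lastP: s => [|s z] in ltn rs ls {ncs} *.
  by have := dinv_neq y; rewrite -ls eqxx.
rewrite last_rcons in ls; have {ls} ez : z = dinv y by rewrite ls dinvK.
subst z; have [pys nl] : path (@noback G) y s /\ dinv y != dinv (last y s).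
  by move: rs; rewrite /reduced /= rcons_path => /andP[].
have sn0 : s != [::] by case: s nl {ltn rs pys} => //=; rewrite eqxx.
have rs' : reduced s by exact: path_sorted pys.
have lts : (size s < n)%N by move: ltn; rewrite /= size_rcons; exact: ltnW.
have [n0 hv lv] := IH s lts sn0 rs'.
have -> : y :: rcons s (dinv y) = winv [:: dinv y] ++ s ++ [:: dinv y].
  by rewrite /winv /= dinvK cats1.
rewrite red_wpow_conj -red_catm /winv /= dinvK cats1.
have rv : reduced (red (wpow s k.+1)) by exact: red_reduced.
case: (red (wpow s k.+1)) => [//|v0 v] /= in n0 hv lv rv *.
rewrite -/(red (rcons (v0 :: v) (dinv y))).
rewrite -[red_cons _ _]/(red (y :: rcons (v0 :: v) (dinv y))).
(* The reduced power has the end letters of [s], next to which [y] and [dinv y] do not cancel, so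
   the conjugated word is already reduced. *)
rewrite red_id; last first.
  rewrite /reduced /= rcons_path rv lv /=.
  case: s hv sn0 pys nl {IH ltn rs rs' lts lv} => //= s0 s -> _ /andP[-> _] /=.
  by rewrite /noback.
by split; rewrite /= ?last_rcons ?last_cat.
Qed.

End Words.

(** * Shortest paths and functions constant along a walk *)

Section ShortestPath.
Variable G : graph.

(** Crossing the first edge again would leave a shortcut: drop everything up to the second crossing,
    keeping one copy of [d] if the direction is the same. *)
Lemma shortest_path_uncons (x y : vtx G) (d : dart G) s :
  shortest_path x y (d :: s) ->
  [/\ dsrc d = x, walk_to (dtgt d) y s & all (fun d' => d'.1 != d.1) s].
Proof.
rewrite /shortest_path /walk_to /= => -[/andP[/andP[/eqP dx ws] /eqP ey] sp].
split=> //; first by rewrite ws /= -ey /wend.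
apply/allP => d' /splitPr ss; apply/eqP => e.
case: ss ws ey sp => s1 s2; rewrite walk_cat /= => /and3P[_ _ w2] ey sp.
have e2 : wend (dtgt d') s2 = y.
  by rewrite -ey /wend /= map_cat last_cat.
have [ed|ed] := dart_same_edge e.
  have := sp (d :: s2).
  rewrite /= dx eqxx -ed w2 /wend /= -/(wend _ s2) e2 eqxx.
  by move=> /(_ isT); rewrite size_cat /= addnS !ltnS leqNgt ltnS leq_addl.
have := sp s2; rewrite ed dtgt_inv dx in w2 e2.
rewrite w2 e2 eqxx => /(_ isT).
by rewrite size_cat /= addnS leqNgt ltnS leqW // leq_addl.
Qed.

Lemma walk_const (T : Type) (phi : vtx G -> T) (e : edg G) x y s :
  (forall z, z != e -> phi (src z) = phi (tgt z)) ->
  walk_to x y s -> all (fun d => d.1 != e) s -> phi x = phi y.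
Proof.
move=> h; rewrite /walk_to => /andP[]; elim: s x => [|d s IH] x /=.
  by rewrite /wend /= => _ /eqP->.
move=> /andP[/eqP <- w] ey /andP[ne a].
rewrite -(IH _ w ey a) /dsrc /dtgt.
by case: d.2; rewrite h.
Qed.

End ShortestPath.

(** * The two sides of an edge in the universal cover *)

Section Cover.
Variables (G : graph) (x0 : vtx G).
Local Notation cvtx := (vtx (ucover x0)).
Local Notation cedg := (edg (ucover x0)).
Implicit Types (u v : cvtx) (z : cedg) (a b w : pi1 x0) (d : dart (ucover x0)).

Lemma cover_vtx_reduced v : reduced (val v).
Proof. by case: v => s /= /andP[]. Qed.

Lemma act_vtxM a b v : act_vtx a (act_vtx b v) = act_vtx (a * b)%g v.
Proof. by apply/val_inj; rewrite /= red_catr red_catl catA. Qed.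

Lemma act_vtx1 v : act_vtx 1%g v = v.
Proof. by apply/val_inj; rewrite /= red_id // cover_vtx_reduced. Qed.

Lemma act_src a z : src (act_edg a z) = act_vtx a (src z).
Proof. by []. Qed.

Lemma act_tgt a z : tgt (act_edg a z) = act_vtx a (tgt z).
Proof.
by apply/val_inj; rewrite /= -!cats1 red_catl red_catr catA.
Qed.

Lemma cover_edg_inj z z' :
  src z = src z' -> cover_eproj z = cover_eproj z' -> z = z'.
Proof.
case: z z' => [[p e] h] [[p' e'] h'] /=.
rewrite /cover_eproj /cover_src /= => ep ee.
by apply/val_inj; rewrite /= ep ee.
Qed.

Lemma act_edgM a b z : act_edg a (act_edg b z) = act_edg (a * b)%g z.
Proof. by apply: cover_edg_inj => //; exact: act_vtxM. Qed.

Lemma act_edg1 z : act_edg 1%g z = z.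
Proof. by apply: cover_edg_inj => //; exact: act_vtx1. Qed.

Lemma act_edgK a : cancel (act_edg (x0 := x0) a) (act_edg a^-1%g).
Proof. by move=> z; rewrite act_edgM mulVg act_edg1. Qed.

(** Induction on the reduced path that defines a vertex: removing its last letter moves to a
    neighbour. *)
Lemma cover_connected (phi : cvtx -> bool) :
  (forall z, phi (src z) = phi (tgt z)) -> forall u v, phi u = phi v.
Proof.
move=> h; suff H v : phi v = phi (cover_base x0) by move=> u v; rewrite !H.
case: v => s hs; elim/last_ind: s hs => [|s [e b] IH] hs.
  by congr phi; apply/val_inj.
have hs' : walk x0 s && reduced s.
  move: hs; rewrite -cats1 walk_cat /reduced.
  by move=> /andP[/andP[-> _] /cat_sorted2[]].
have ws : dsrc (e, b) = wend x0 s.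
  by move: hs; rewrite -cats1 walk_cat /= andbT => /andP[/andP[_ /eqP]].
rewrite -(IH hs'); case: b hs ws => hs ws.
  (* For a reversed letter, the edge of the cover starts at the longer path. *)
  have hz : cover_vproj (CoverVtx hs) == src e.
    by rewrite /cover_vproj /= -cats1 wend_cat.
  have := h (@CoverEdg _ _ (CoverVtx hs, e) hz) => /= ->; congr phi.
  apply/val_inj; rewrite /= /cover_tgt /= -!cats1 -catA.
  have := red_catmV s [:: (e, true)] [::]; rewrite /winv /= cats0 => ->.
  by rewrite red_id //; case/andP: hs'.
have hz : cover_vproj (CoverVtx hs') == src e by rewrite /cover_vproj /= -ws.
have := h (@CoverEdg _ _ (CoverVtx hs', e) hz) => /= ->; congr phi.
by apply/val_inj; rewrite /= red_id //; case/andP: hs.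
Qed.

Definition dproj d : dart G := (cover_eproj d.1, d.2).

Lemma cover_dtgt d : val (dtgt d) = red (rcons (val (dsrc d)) (dproj d)).
Proof.
case: d => z [] //=; rewrite /dsrc /dtgt /dproj /=.
rewrite -!cats1 red_catl -catA /= /cover_eproj.
have := red_catmV (val (cover_src z)) [:: ((val z).2, false)] [::].
by rewrite /winv /= cats0 => ->; rewrite red_id //; exact: cover_vtx_reduced.
Qed.

(* The vertices on the far side of the edge underlying [d], that is, those whose
   geodesic from [dsrc d] starts with [d]. *)
Definition beyond d v : bool :=
  ohead (red (winv (val (dsrc d)) ++ val v)) == Some (dproj d).

Lemma beyond_src d : beyond d (dsrc d) = false.
Proof. by rewrite /beyond red_winvl. Qed.

(** The word from [dtgt d] to [v] is the word from [dsrc d] with the inverse letter of [d] put in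
    front; it starts with that letter exactly when nothing cancels. *)
Lemma beyond_inv d v : beyond (dinv d) v = ~~ beyond d v.
Proof.
rewrite /beyond dsrc_inv cover_dtgt red_winv_red -cats1 winv_cat -catA.
have -> : dproj (dinv d) = dinv (dproj d) by [].
have -> : winv [:: dproj d] = [:: dinv (dproj d)] by [].
rewrite -red_catr /=.
rewrite -/(red (red _)) (red_id (red_reduced _)).
rewrite red_cons_ohead; last exact: red_reduced.
by rewrite dinvK.
Qed.

Lemma beyond_tgt d : beyond d (dtgt d).
Proof. by rewrite -[beyond _ _]negbK -beyond_inv -dsrc_inv beyond_src. Qed.

(** Crossing [z] appends one letter to the word from [dsrc d]. Its first letter could become that of
    [d] only from the empty word, and then [z] would be the edge of [d]. *)
Lemma beyond_edg d z : z != d.1 -> beyond d (src z) = beyond d (tgt z).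
Proof.
(* Reversing [d] negates both sides, so the letter of [d] may be taken positive; the letter appended
   by [z] is then not its inverse. *)
wlog db : d / d.2 = false => [H|] nz.
  case db: d.2; last exact: H.
  by apply/negb_inj; rewrite -!beyond_inv; apply: H; rewrite //= db.
have es : dsrc d = src d.1 by rewrite /dsrc db.
rewrite /beyond; set p := val (dsrc d).
rewrite [val (tgt z)]/(red (rcons (val (src z)) (cover_eproj z, false))).
rewrite red_catr -cats1 catA -[red (_ ++ [:: _])]red_catl cats1.
rewrite ohead_red_rcons //; first exact: red_reduced.
  by rewrite /dproj db xpair_eqE andbF.
apply/negP => /andP[/eqP /red_winvl_eq0 e0]; rewrite /dproj => /eqP[e1 _].
move/negP: nz; apply; apply/eqP/cover_edg_inj => //.
rewrite -es; apply/val_inj/esym/e0; exact: cover_vtx_reduced.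
Qed.

(** Seen from [dsrc d], a power of [w] gives the reduced power of the word [s] that [w] gives, and
    taking powers keeps the first letter. *)
Lemma beyond_expg d w k : beyond d (act_vtx w (dsrc d)) ->
  beyond d (act_vtx (w ^+ k.+1)%g (dsrc d)).
Proof.
rewrite /beyond; set p := val (dsrc d); set s := red (winv p ++ _).
have -> : red (winv p ++ val (act_vtx (w ^+ k.+1)%g (dsrc d))) =
          red (wpow s k.+1).
  have -> : s = red (winv p ++ val w ++ p) by rewrite /s /= red_catr.
  rewrite red_wpow; elim: k.+1 => [|n IH].
    by rewrite expg0 /= red_catr red_winvl.
  rewrite /= red_catr in IH.
  rewrite wpowS -[RHS]red_catr -IH expgS /= !red_catr red_catm.
  have := red_catmV (winv p ++ val w) p (val (w ^+ n)%g ++ p).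
  by rewrite -!catA.
move=> /eqP hs; have sn0 : s != [::] by case: (s) hs.
have [] := red_wpow_ends k (dproj d) sn0 (red_reduced _).
case: (red (wpow s k.+1)) => //= x t _ -> _.
by case: (s) hs => //= ? ? ->.
Qed.

(* The half-tree of [dsrc d] does not contain the translate of the edge of [d]
   by [a], hence lies on one side of this translate. *)
Lemma beyond_translate d a v : beyond d (act_vtx a (dsrc d)) -> ~~ beyond d v ->
  beyond d (act_vtx a^-1%g v) = beyond d (act_vtx a^-1%g (dsrc d)).
Proof.
move=> ha; set c := beyond d (act_vtx _ (dsrc d)).
(* [phi] is constant along every edge: it holds at both ends of the edge of [d] and of its translate
   by [a], the latter lying beyond [d]; along any other edge neither disjunct changes. *)
pose phi v := beyond d v || (beyond d (act_vtx a^-1%g v) == c).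
suff H : phi v = phi (dsrc d).
  by move: H; rewrite /phi eqxx orbT => /orP[-> //|/eqP].
apply: cover_connected => z.
have phi1 : phi (dsrc d) = phi (dtgt d).
  by rewrite /phi beyond_tgt eqxx orbT.
have [->|nz] := eqVneq z d.1.
  by move: phi1; rewrite /dsrc /dtgt; case: d.2.
have [ez|nz'] := eqVneq (act_edg a^-1%g z) d.1.
  have {}ez : z = act_edg a d.1 by rewrite -ez -{1}(invgK a) act_edgK.
  suff /andP[h1 h2] : beyond d (src z) && beyond d (tgt z).
    by rewrite /phi h1 h2.
  have := beyond_edg nz; move: ha; rewrite ez act_src act_tgt /dsrc.
  by case: d.2 => -> => [->|<-].
rewrite /phi (beyond_edg nz); congr (_ || (_ == _)).
by have := beyond_edg nz'; rewrite act_tgt.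
Qed.

End Cover.

(** * Continuity in the weak topology *)

Section RealizationMaps.
Variables (R : realType) (G : graph).

Lemma realization_openE (U : set (realization R G)) :
  open U = (forall e, open (ept e @^-1` U)).
Proof. by []. Qed.

Lemma continuous_ept (e : edg G) : continuous (ept (R := R) e).
Proof. by apply/continuousP => U; rewrite realization_openE; exact. Qed.

Lemma realization_continuous (T : topologicalType) (h : realization R G -> T) :
  (forall e, continuous (h \o ept e)) -> continuous h.
Proof.
move=> hc; apply/continuousP => U oU; rewrite realization_openE => e.
by have /continuousP := hc e; exact.
Qed.

Lemma eptE (e : edg G) (u : {t : R | 0 < t < 1}) : ept e (val u) = inr (e, u).
Proof. by rewrite /ept valK. Qed.

Lemma ept0 (e : edg G) : ept e (0 : R) = inl (src e).
Proof. by rewrite /ept insubF ?ltxx // lexx. Qed.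

Lemma ept1 (e : edg G) : ept e (1 : R) = inl (tgt e).
Proof. by rewrite /ept insubF ?ltxx ?andbF // ler10. Qed.

End RealizationMaps.

(** * The action on the tree and the retraction onto an edge *)

Section Retraction.
Variables (R : realType) (G : graph) (x0 : vtx G).
Local Notation cover := (realization R (ucover x0)).
Implicit Types (a b : pi1 x0) (d : dart (ucover x0)) (x : cover).

Lemma act_ept a z t : act a (ept z t : cover) = ept (act_edg a z) t.
Proof.
rewrite /ept; case: insubP => // _.
by case: ifP => _ //=; congr inl; rewrite -act_tgt.
Qed.

Lemma continuous_act a : continuous (act (R := R) a).
Proof.
apply: realization_continuous => z.
rewrite (_ : _ \o _ = ept (act_edg a z)); first exact: continuous_ept.
by apply/funext => t; exact: act_ept.
Qed.

Lemma actM a b x : act a (act b x) = act (a * b)%g x.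
Proof. by case: x => [v|[z u]] /=; rewrite ?act_vtxM ?act_edgM. Qed.

Lemma act1 x : act 1%g x = x.
Proof. by case: x => [v|[z u]] /=; rewrite ?act_vtx1 ?act_edg1. Qed.

Lemma cover_proj_act a x : cover_proj (act a x) = cover_proj x.
Proof.
case: x => [v|[z u]] //=; congr inl; rewrite /cover_vproj.
case: a v => [s /= /andP[/andP[ws /eqP es] _]] [p /= /andP[wp _]].
have /walk_red[_ ->] : walk x0 (s ++ p) by rewrite walk_cat ws es.
by rewrite wend_cat es.
Qed.

Definition dept d (t : R) : cover := ept d.1 (if d.2 then 1 - t else t).

Lemma continuous_dept d : continuous (dept d).
Proof.
rewrite /dept; case: d.2; last exact: continuous_ept.
move=> t; apply: (@continuous_comp _ _ _ (fun t : R => 1 - t)).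
  by apply: cvgB; [exact: cvg_cst|exact: cvg_id].
exact: continuous_ept.
Qed.

Lemma dept_inv d t : dept (dinv d) t = dept d (1 - t).
Proof. by rewrite /dept /=; case: d.2; rewrite ?subKr. Qed.

Lemma dept0 d : dept d 0 = inl (dsrc d).
Proof. by rewrite /dept /dsrc; case: d.2; rewrite ?subr0 ?ept0 ?ept1. Qed.

Lemma dept1 d : dept d 1 = inl (dtgt d).
Proof. by rewrite /dept /dtgt; case: d.2; rewrite ?subrr ?ept0 ?ept1. Qed.

(** The retraction of the tree onto the edge of [d], read in the coordinate of [dept d]: each
    half-tree collapses to its end of the edge. *)
Definition retract d x : R :=
  match x with
  | inl v => (beyond d v)%:R
  | inr (z, u) => if z == d.1 then if d.2 then 1 - val u else val u
                  else (beyond d (src z))%:R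
  end.

Lemma retract_bounds d x : 0 <= retract d x <= 1.
Proof.
case: x => [v|[z [u /= /andP[u0 u1]]]] /=.
  by case: beyond; rewrite ?lexx ler01.
case: eqP => _; last by case: beyond; rewrite ?lexx ler01.
by case: d.2; rewrite ?subr_ge0 ?gerBl !ltW.
Qed.

(** Points off the open edge have coordinate 0 or 1. Hence fixed points found after retracting are
    genuine once their coordinates are interior. *)
Lemma dept_retract d x : 0 < retract d x < 1 -> x = dept d (retract d x).
Proof.
case: x => [v|[z u]] /=; first by case: beyond; rewrite ltxx ?andbF.
case: eqP => [-> _|_]; last by case: beyond; rewrite ltxx ?andbF.
by rewrite /dept; case: d.2; rewrite ?subKr eptE.
Qed.

Lemma continuous_retract d : continuous (retract d).
Proof.
apply: realization_continuous => z; have [->|nz] := eqVneq z d.1; last first.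
  rewrite (_ : _ \o _ = cst (beyond d (src z))%:R); first exact: cst_continuous.
  apply/funext => t /=; rewrite /ept; case: insubP => [u _ _|_] /=.
    by rewrite (negbTE nz).
  by case: ifP => _ //=; rewrite (beyond_edg nz).
(* [ept] is constant outside the unit interval, so on its own edge the retraction reads as
   truncation to that interval. *)
pose clamp : R -> R := cst 0 \max (id \min cst 1).
have cc : continuous clamp.
  move=> t; apply: continuous_max; first exact: cvg_cst.
  by apply: continuous_min; [exact: cvg_id|exact: cvg_cst].
rewrite (_ : _ \o _ = fun t => if d.2 then 1 - clamp t else clamp t).
  case: d.2 => // t; apply: cvgB; [exact: cvg_cst|exact: cc].
have [bs bt] : (beyond d (src d.1) = d.2) /\ (beyond d (tgt d.1) = ~~ d.2).
  have := beyond_src d; have := beyond_tgt d; rewrite /dsrc /dtgt.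
  by case: d.2 => -> ->.
apply/funext => t; rewrite /= /ept /clamp /=.
case: insubP => [u /andP[u0 u1] eu|] /=.
  by rewrite eqxx eu (min_l (ltW u1)) (max_r (ltW u0)).
rewrite negb_and -!leNgt; have [t0 _|t0] /= := leP t 0.
  rewrite bs (min_l (le_trans t0 ler01)) (max_l t0).
  by case: d.2; rewrite ?subr0.
move=> t1; rewrite bt (min_r t1) (max_r ler01).
by case: d.2; rewrite ?subrr.
Qed.

End Retraction.

(** * Fixed points forced by reversing an edge *)

Lemma crossing_fixpoint (R : realType) (h : R -> R) :
  continuous h -> h 0 = 1 -> h 1 = 0 -> exists2 t, 0 < t < 1 & h t = t.
Proof.
move=> hc h0 h1.
have [||t] := @IVT R (fun t => h t - t) 0 1 0 ler01.
- apply: continuous_subspaceT => t; apply: cvgB; [exact: hc|exact: cvg_id].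
- by rewrite h0 h1 subr0 sub0r ge_min le_max ler01 lerN10 orbT.
rewrite in_itv /= => /andP[t0 t1] /eqP; rewrite subr_eq0 => /eqP ht.
(* The fixed point is not an end, because [h] exchanges the ends. *)
exists t => //; rewrite !lt_neqAle t0 t1 !andbT; apply/andP; split.
  by apply/eqP => e; move: ht; rewrite -e h0 => /eqP; rewrite oner_eq0.
by apply/eqP => e; move: ht; rewrite e h1 => /eqP; rewrite eq_sym oner_eq0.
Qed.
Lemma iter_continuous (T : topologicalType) (f : T -> T) n :
  continuous f -> continuous (iter n f).
Proof.
move=> fc; elim: n => [|n IH] x; first exact: cvg_id.
by apply: (@continuous_comp _ _ _ (iter n f) f); [exact: IH|exact: fc].
Qed.

Section ForcedPoints.
Variables (R : realType) (G : graph) (x0 : vtx G).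
Local Notation cover := (realization R (ucover x0)).
Implicit Types (w : pi1 x0) (d : dart (ucover x0)) (F K : cover -> cover).

(** After retraction [F] keeps the ends of the edge and [K] exchanges them, so the composite has an
    interior fixed point. *)
Lemma preserving_reversing_fixpoint d F K u v u' v' :
    continuous F -> continuous K ->
    F (inl (dsrc d)) = inl u -> F (inl (dtgt d)) = inl v ->
    ~~ beyond d u -> beyond d v ->
    K (inl (dsrc d)) = inl u' -> K (inl (dtgt d)) = inl v' ->
    beyond d u' -> ~~ beyond d v' ->
  exists2 t, 0 < t < 1 & K (F (dept d t)) = dept d t.
Proof.
move=> Fc Kc Fs Ft bu bv Ks Kt bu' bv'.
pose h t := retract d (F (dept d t)); pose k t := retract d (K (dept d t)).
have ret F' : continuous F' -> continuous (fun t => retract d (F' (dept d t))).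
  move=> F'c t; apply: (@continuous_comp _ _ _ (F' \o dept d)).
    by apply: continuous_comp; [exact: continuous_dept|exact: F'c].
  exact: continuous_retract.
have k0 : k 0 = 1 by rewrite /k dept0 Ks /= bu'.
have k1 : k 1 = 0 by rewrite /k dept1 Kt /= (negbTE bv').
have [||| t t01 kht] := @crossing_fixpoint R (k \o h).
- by move=> t; apply: continuous_comp; exact: ret.
- by rewrite /= /h dept0 Fs /= (negbTE bu).
- by rewrite /= /h dept1 Ft /= bv.
exists t => //; rewrite /= in kht.
(* If [h t] were 0 or 1, then [k (h t)] would be 1 or 0 and could not equal the interior [t]. So the
   first retraction did not move its point. *)
have Fh : F (dept d t) = dept d (h t).
  apply: dept_retract; have /andP[h0 h1] := retract_bounds d (F (dept d t)).
  rewrite -/(h t) in h0 h1 *; rewrite !lt_neqAle h0 h1 !andbT.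
  have /andP[/gt_eqF t0 /lt_eqF t1] := t01.
  apply/andP; split; apply/eqP => e; move: kht; rewrite -?e ?k0 ?e ?k1 => /eqP.
    by rewrite eq_sym t1.
  by rewrite eq_sym t0.
by rewrite Fh [LHS](@dept_retract _ _ _ d) -/(k _) kht.
Qed.

Lemma reversing_fixpoint d K u v : continuous K ->
    K (inl (dsrc d)) = inl u -> K (inl (dtgt d)) = inl v ->
    beyond d u -> ~~ beyond d v ->
  exists2 t, 0 < t < 1 & K (dept d t) = dept d t.
Proof.
move=> Kc Ks Kt bu bv.
apply: (@preserving_reversing_fixpoint d id K (dsrc d) (dtgt d) u v) => //.
- by move=> x; exact: cvg_id.
- by rewrite beyond_src.
- exact: beyond_tgt.
Qed.

Variable ft : cover -> cover.
Hypotheses (ft_continuous : continuous ft)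
  (ft_act : forall a x, ft (act a x) = act a (ft x)).

Lemma iter_act k a x : iter k ft (act a x) = act a (iter k ft x).
Proof. by elim: k => //= k ->; rewrite ft_act. Qed.

Lemma iter_rotate n w v k : iter n ft (inl v) = inl (act_vtx w v) ->
  iter (k * n) ft (inl v) = inl (act_vtx (w ^+ k)%g v).
Proof.
move=> h; elim: k => [|k IH]; first by rewrite expg0 act_vtx1.
rewrite mulSn addnC iterD h -[inl (act_vtx w v)]/(act w (inl v)) iter_act IH /=.
by rewrite act_vtxM expgS.
Qed.

(** Stated for a dart rather than an edge, so that reversing it gives the second half of the
    theorem. *)
Lemma forced_rotation d m n w w' (r : rat) :
    (0 < m)%N -> (0 < n)%N ->
    iter m ft (inl (dsrc d)) = inl (act_vtx w (dsrc d)) ->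
    iter n ft (inl (dtgt d)) = inl (act_vtx w' (dtgt d)) ->
    beyond d (act_vtx w (dsrc d)) -> ~~ beyond d (act_vtx w' (dtgt d)) ->
    0 <= r < m%:R^-1 ->
  exists t N i, [/\ 0 < t < 1, (0 < N)%N, r = i%:R / N%:R
    & iter N ft (dept d t) = act (w ^+ i)%g (dept d t)].
Proof.
move=> m0 n0 hs ht bs bt /andP[r0 rm].
have [p [q [q0 er]]] : exists p q, (0 < q)%N /\ r = p%:R / q%:R :> rat.
  exists `|numq r|%N, `|denq r|%N; rewrite absz_gt0 denq_eq0; split=> //.
  rewrite -{1}(divq_num_den r) -[RHS]/((`|numq r|%:Z)%:~R / (`|denq r|%:Z)%:~R).
  by rewrite absz_denq gez0_abs // numq_ge0.
have pmq : (p * m < q)%N.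
  move: rm; rewrite er ltr_pdivrMr ?ltr0n // mulrC ltr_pdivlMr ?ltr0n //.
  by rewrite -natrM ltr_nat.
(* With these choices [a + b = q * n * m] and [r = i / (a + b)]. Both [a] and [b] are multiples of
   [m] and of [n], so the images of both ends are known; [e > 0] expresses [r < 1 / m]. *)
pose i := (p * m * n)%N; pose a := (i * m)%N.
pose e := (q - p * m)%N; pose b := (e * n * m)%N.
have e0 : (0 < e)%N by rewrite subn_gt0.
have N0 : (0 < b + a)%N by rewrite addn_gt0 !muln_gt0 e0 n0 m0.
have eN : (b + a = q * n * m)%N.
  by rewrite /a /i /b -!mulnDl subnK // ltnW.
have ri : r = i%:R / (b + a)%:R.
  rewrite er eN /i !natrM -(mulrA p%:R) -(mulrA q%:R) (mulrC n%:R) -mulf_div.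
  by rewrite divff ?mulr1 // mulf_neq0 // pnatr_eq0 -lt0n.
have rotS k :
    iter (k * m) ft (inl (dsrc d)) = inl (act_vtx (w ^+ k)%g (dsrc d)).
  exact: iter_rotate.
have rotT k :
    iter (k * n) ft (inl (dtgt d)) = inl (act_vtx (w' ^+ k)%g (dtgt d)).
  exact: iter_rotate.
have bS k : (0 < k)%N -> beyond d (act_vtx (w ^+ k)%g (dsrc d)).
  by case: k => // k _; exact: beyond_expg.
have bT k : (0 < k)%N -> ~~ beyond d (act_vtx (w' ^+ k)%g (dtgt d)).
  case: k => // k _; rewrite -beyond_inv -dsrc_inv; apply: beyond_expg.
  by rewrite dsrc_inv beyond_inv.
pose g := (w ^+ i)%g.
have cont k : continuous (act (R := R) g^-1%g \o iter k ft).
  move=> x; apply: continuous_comp; first exact: iter_continuous.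
  exact: continuous_act.
(* The vertex moved by [w' ^+ k] is on the near side, hence [beyond_translate] applies. It needs [g]
   to move [dsrc d] beyond [d], so [i = 0] is separate. *)
have side k : (0 < k)%N ->
    beyond d (act_vtx g^-1%g (act_vtx (w' ^+ k)%g (dtgt d))) =
    beyond d (act_vtx g^-1%g (dsrc d)).
  move=> k0; rewrite /g; have [->|i0] := posnP i.
    by rewrite expg0 invg1 !act_vtx1 beyond_src; apply/negbTE/bT.
  by apply: beyond_translate; [exact: bS|exact: bT].
(* If true, [g^-1] carries the near half-tree to the far side and two maps are needed; the false
   case includes [i = 0] and needs only one. *)
case c : (beyond d (act_vtx g^-1%g (dsrc d))).
- have i0 : (0 < i)%N.
    rewrite lt0n; apply/eqP => i0; move: c.
    by rewrite /g i0 expg0 invg1 act_vtx1 beyond_src.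
  have ai : a = (p * m * m * n)%N by rewrite /a /i mulnAC.
  have pm0 : (0 < p * m * m)%N.
    by move: i0; rewrite /i !muln_gt0 => /andP[/andP[-> ->]].
  have [||||||||||t t01 hT] := @preserving_reversing_fixpoint d
      (act g^-1%g \o iter a ft) (iter b ft)
      (dsrc d) (act_vtx g^-1%g (act_vtx (w' ^+ (p * m * m))%g (dtgt d)))
      (act_vtx (w ^+ (e * n))%g (dsrc d)) (act_vtx (w' ^+ (e * m))%g (dtgt d)).
  + exact: cont.
  + exact: iter_continuous.
  + by rewrite /= rotS /= act_vtxM mulVg act_vtx1.
  + by rewrite /= ai rotT.
  + by rewrite beyond_src.
  + by rewrite side.
  + exact: rotS.
  + by rewrite /b mulnAC rotT.
  + by apply: bS; rewrite muln_gt0 e0.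
  + by apply: bT; rewrite muln_gt0 e0.
  exists t, (b + a)%N, i; split=> //.
  (* The action commutes with the iterates, so the composite of the two maps is [g^-1] after the
     iterate of order [b + a]. *)
  move: hT; rewrite /= iter_act -iterD => hT.
  by rewrite -[in RHS]hT actM mulgV act1.
have [|||||t t01 hT] := @reversing_fixpoint d (act g^-1%g \o iter (b + a) ft)
    (act_vtx (w ^+ (e * n))%g (dsrc d))
    (act_vtx g^-1%g (act_vtx (w' ^+ (q * m))%g (dtgt d))).
- exact: cont.
- rewrite /= /a /b -mulnDl rotS /= addnC expgnDr -act_vtxM; congr inl.
  by rewrite act_vtxM mulVg act_vtx1.
- by rewrite /= eN mulnAC rotT.
- by apply: bS; rewrite muln_gt0 e0.
- by rewrite side ?c // muln_gt0 m0 andbT (leq_ltn_trans _ pmq).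
exists t, (b + a)%N, i; split=> //.
by rewrite -[in RHS]hT /= actM mulgV act1.
Qed.

End ForcedPoints.

(** * From the labeled graph to the tree and back *)

Lemma beyond_shortest_path (G : graph) (x0 : vtx G) (d : dart (ucover x0)) v P :
  shortest_path (dsrc d) v P -> begins_with d.1 P -> beyond d v.
Proof.
case: P => // d' s /shortest_path_uncons[es ws al] /= /eqP ed.
have {}ed : d' = d.
  have [//|e] := @dart_same_edge (ucover x0) _ _ ed.
  by have := beyond_src d; rewrite -es e dsrc_inv beyond_tgt.
(* The rest of the path avoids the edge of [d], so it stays on the side of [dtgt d]. *)
by subst d'; rewrite -(walk_const (@beyond_edg _ _ d) ws al) beyond_tgt.
Qed.

Lemma tgt_elift (G : graph) (x0 : vtx G) (L : coherent_labeling x0) e :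
  e \in cl_tree L -> tgt (elift L e) = vlift L (tgt e).
Proof.
by move=> /vlift_tree[e' [pe es <-]]; congr tgt; exact: cover_edg_inj.
Qed.

Lemma iter_cover_proj (R : realType) (G : graph) (x0 : vtx G)
    (f : realization R G -> realization R G)
    (ft : realization R (ucover x0) -> realization R (ucover x0)) k x :
  (forall x, cover_proj (ft x) = f (cover_proj x)) ->
  cover_proj (iter k ft x) = iter k f (cover_proj x).
Proof. by move=> h; elim: k => //= k <-. Qed.

(** The point has rotation element [(w^i)^(1/N)], which is formally [w^(i/N)]. *)
Lemma rotation_element_interior (R : realType) (G : graph) (x0 : vtx G)
    (L : coherent_labeling x0) (f : realization R G -> realization R G)
    (ft : realization R (ucover x0) -> realization R (ucover x0))
    (E : edg G) (w : pi1 x0) (t : R) (N i : nat) :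
  equivariant_lift f ft -> 0 < t < 1 -> (0 < N)%N ->
  iter N ft (ept (elift L E) t) = act (w ^+ i)%g (ept (elift L E) t) ->
  rotation_element L f ft (ept E t) (w, i%:R / N%:R).
Proof.
case=> _ ft_proj _ t01 N0 h.
pose u : {t : R | 0 < t < 1} := exist _ t t01.
have et H (e : edg H) : ept e t = inr (e, u) by rewrite -eptE.
exists N, (w ^+ i)%g; split; last exact: (qpow_mul w i%:Z).
have lt : plift L (ept E t) = ept (elift L E) t by rewrite !et.
split; rewrite ?lt //.
rewrite (_ : ept E t = cover_proj (ept (elift L E) t)); last by rewrite !et.
by rewrite -(iter_cover_proj _ _ ft_proj) h cover_proj_act.
Qed.

Theorem theorem26 (R : realType) (G : graph) (x0 : vtx G)
  (G_finite : finite_graph G) (G_connected : connected_graph G)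
  (G_loopless : loopless G)
  (L : coherent_labeling x0)
  (f : realization R G -> realization R G)
  (f_continuous : continuous f) (f_vertex : vertex_map f)
  (f_homotopic : homotopic f id)
  (ft : realization R (ucover x0) -> realization R (ucover x0))
  (ft_lift : equivariant_lift f ft)
  (E : edg G) (E_tree : E \in cl_tree L)
  (m n : nat) (w1 w2 : pi1 x0)
  (V1_periodic : rotates L f ft m w1 (vpt R (src E)))
  (V2_periodic : rotates L f ft n w2 (vpt R (tgt E)))
  (P1 P2 : seq (dart (ucover x0)))
  (P1_shortest :
    shortest_path (vlift L (src E)) (act_vtx w1 (vlift L (src E))) P1)
  (P2_shortest :
    shortest_path (vlift L (tgt E)) (act_vtx w2 (vlift L (tgt E))) P2)
  (E_belongs1 : belongs E w1) (E_belongs2 : belongs E w2)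
  (P1_begins : begins_with (elift L E) P1)
  (P2_begins : begins_with (elift L E) P2)
  (r s : rat) (r_bounds : 0 <= r < m%:R^-1) (s_bounds : 0 <= s < n%:R^-1) :
  (exists x, closed_edge E x /\ rotation_element L f ft x (w1, r)) /\
  (exists y, closed_edge E y /\ rotation_element L f ft y (w2, s)).

Proof.
case: (ft_lift) => ft_continuous _ ft_act.
case: V1_periodic V2_periodic => m0 _ rot1 [n0 _ rot2].
pose d : dart (ucover x0) := (elift L E, false).
have sd : dsrc d = vlift L (src E) by [].
have td : dtgt d = vlift L (tgt E) by exact: tgt_elift.
rewrite /= -sd in rot1; rewrite /= -td in rot2.
rewrite -sd in P1_shortest; rewrite -td in P2_shortest.
have b1 := @beyond_shortest_path _ _ d _ _ P1_shortest P1_begins.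
rewrite -dsrc_inv in P2_shortest.
have b2 := @beyond_shortest_path _ _ (dinv d) _ _ P2_shortest P2_begins.
have closed t : 0 < t < 1 -> closed_edge E (ept E t).
  by move=> /andP[t0 t1]; exists t; rewrite //= in_itv /= !ltW.
split.
  have b2' : ~~ beyond d (act_vtx w2 (dtgt d)) by rewrite -beyond_inv -dsrc_inv.
  have [t [N [i [t01 N0 -> h]]]] :=
    forced_rotation ft_continuous ft_act m0 n0 rot1 rot2 b1 b2' r_bounds.
  by exists (ept E t); split; [exact: closed|exact: rotation_element_interior].
have b1' : ~~ beyond (dinv d) (act_vtx w1 (dtgt (dinv d))).
  by rewrite beyond_inv negbK dtgt_inv.
rewrite -dsrc_inv in rot2; rewrite -dtgt_inv in rot1.
have [t [N [i [t01 N0 -> h]]]] :=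
  forced_rotation ft_continuous ft_act n0 m0 rot2 rot1 b2 b1' s_bounds.
have t01' : 0 < 1 - t < 1.
  by case/andP: t01 => t0 t1; rewrite subr_gt0 t1 gtrBl t0.
(* Here [t] is measured from the terminal vertex of [E]. *)
exists (ept E (1 - t)); split; first exact: closed.
by apply: rotation_element_interior => //; move: h; rewrite dept_inv.
Qed.
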